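(* There are two compactifications $\gamma\omega$ and $\eta\omega$ of $\omega$ such that $\gamma\omega\setminus\omega$ is homeomorphic to $\eta\omega\setminus\omega$, while $\eta\omega$ is smooth and $\gamma\omega$ is not smooth.
   Context: $\omega$ is the discrete space of natural numbers; compactifications are Hausdorff. $C(K)$ is the Banach space of real-valued continuous functions on a compact space $K$ with the supremum norm. For a compactification $\gamma\omega$ of $\omega$, the natural copy of $c_0$ in $C(\gamma\omega)$ is the closed subspace $\{f\in C(\gamma\omega): f|(\gamma\omega\setminus\omega)\equiv 0\}$. The compactification $\gamma\omega$ is called smooth if the natural copy of $c_0$ is complemented in $C(\gamma\omega)$, i.e. is the range of a bounded linear projection on $C(\gamma\omega)$. *)

(* Defs.v *)
From HB Require Import structures.
From mathcomp Require Import all_boot all_order all_algebra.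
From mathcomp Require Import ring lra.
From mathcomp Require Import all_classical all_reals all_analysis.
Import Order.TTheory GRing.Theory Num.Theory.
Import numFieldNormedType.Exports.

Set Implicit Arguments.
Unset Strict Implicit.
Unset Printing Implicit Defensive.

Local Open Scope classical_set_scope.
Local Open Scope ring_scope.

HB.mixin Record isCompactHausdorff T of Topological T := {
  compactT : compact [set: T];
  hausdorffT : hausdorff_space T
}.

#[short(type="compactHausdorffType")]
HB.structure Definition CompactHausdorff :=
  {T of Topological T & isCompactHausdorff T}.

Definition homeomorphic (X Y : topologicalType) : Prop :=
  exists (f : X -> Y) (g : Y -> X),
    [/\ cancel f g, cancel g f, continuous f & continuous g].

(* The embedding condition says that the topology of X is the one induced by
   cpt_emb; when X is nat (discrete) it says that the image is a discrete
   subspace. *)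
Record compactification (X : topologicalType) := Compactification {
  cpt_space :> compactHausdorffType;
  cpt_emb : X -> cpt_space;
  cpt_emb_inj : injective cpt_emb;
  cpt_emb_open : forall A : set X,
    open A <-> exists2 B : set cpt_space, open B & cpt_emb @^-1` B = A;
  cpt_emb_dense : dense (range cpt_emb)
}.

Definition remainder (X : topologicalType) (c : compactification X) : set c :=
  ~` range (@cpt_emb X c).
Arguments remainder {X} c _.

Definition continuous_pred {R : realType} {K : topologicalType} :
  {pred K -> R} := fun f => `[< continuous f >].

(* The library's continuousType K R carries the compact-open topology as a
   canonical structure, hence a fresh type for the normed space C(K). *)
Record contFun (R : realType) (K : compactHausdorffType) := ContFun {
  contFun_fun :> K -> R;
  contFun_mem : contFun_fun \in continuous_pred
}.

Section contFun_lmodule.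
Context (R : realType) (K : compactHausdorffType).

Lemma continuous_predP (f : K -> R) :
  reflect (continuous f) (f \in continuous_pred).
Proof. exact: asboolP. Qed.

Lemma contFun_continuous (f : contFun R K) : continuous f.
Proof. exact/continuous_predP/contFun_mem. Qed.

HB.instance Definition _ := [isSub for @contFun_fun R K].
HB.instance Definition _ := [Choice of contFun R K by <:].

Lemma continuous_submod_closed : submod_closed (@continuous_pred R K).
Proof.
split; first by apply/continuous_predP => x; exact: cvg_cst.
move=> a f g /continuous_predP cf /continuous_predP cg.
apply/continuous_predP => x.
by apply: cvgD; [apply: cvgZl_tmp; exact: cf|exact: cg].
Qed.

HB.instance Definition _ := GRing.isSubmodClosed.Build _ _
  (@continuous_pred R K) continuous_submod_closed.
HB.instance Definition _ := [SubChoice_isSubLmodule of contFun R K by <:].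

Lemma contFunP (f g : contFun R K) : f = g <-> f =1 g.
Proof. by split=> [->//|fg]; exact/val_inj/funext. Qed.

Lemma contFunDE (f g : contFun R K) x : (f + g) x = f x + g x.
Proof. by []. Qed.

Lemma contFunNE (f : contFun R K) x : (- f) x = - f x.
Proof. by []. Qed.

Lemma contFunBE (f g : contFun R K) x : (f - g) x = f x - g x.
Proof. by []. Qed.

Lemma contFunZE a (f : contFun R K) x : (a *: f) x = a * f x.
Proof. by []. Qed.

Lemma contFun0E x : (0 : contFun R K) x = 0.
Proof. by []. Qed.

End contFun_lmodule.

Section contFun_norm.
Context (R : realType) (K : compactHausdorffType).
Implicit Types f g : contFun R K.

(* If K is empty, this is sup set0 = 0. *)
Definition sup_norm f : R := sup [set `|f x| | x in [set: K]].

Lemma has_ubound_normf f : has_ubound [set `|f x| | x in [set: K]].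
Proof.
have cf : {within [set: K], continuous f}.
  exact/continuous_subspaceT/contFun_continuous.
have /compact_bounded[M [_ fM]] := continuous_compact cf (@compactT K).
exists (M + 1) => _ [x _ <-]; apply: (fM (M + 1)); first by rewrite ltrDl.
by exists x.
Qed.

Lemma le_sup_norm f x : `|f x| <= sup_norm f.
Proof. by apply: ub_le_sup; [exact: has_ubound_normf|exists x]. Qed.

Lemma sup_norm_ge0 f : 0 <= sup_norm f.
Proof.
have [[x]|/nonemptyPn K0] := pselect ([set: K] !=set0).
  by move=> _; exact: le_trans (le_sup_norm f x).
by rewrite /sup_norm K0 image_set0 sup0.
Qed.

Lemma sup_norm_le f M : 0 <= M -> (forall x, `|f x| <= M) -> sup_norm f <= M.
Proof.
move=> M0 fM; have [[x _]|/nonemptyPn K0] := pselect ([set: K] !=set0).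
  by apply: ge_sup; [exists `|f x|, x|move=> _ [y _ <-]].
by rewrite /sup_norm K0 image_set0 sup0.
Qed.

Lemma ler_sup_normD f g : sup_norm (f + g) <= sup_norm f + sup_norm g.
Proof.
apply: sup_norm_le => [|x]; first by rewrite addr_ge0 ?sup_norm_ge0.
by rewrite contFunDE (le_trans (ler_normD _ _))// lerD// le_sup_norm.
Qed.

Lemma sup_normZ a f : sup_norm (a *: f) = `|a| * sup_norm f.
Proof.
have le b g : sup_norm (b *: g) <= `|b| * sup_norm g.
  apply: sup_norm_le => [|x]; first by rewrite mulr_ge0 ?sup_norm_ge0.
  by rewrite contFunZE normrM ler_wpM2l// le_sup_norm.
apply/eqP; rewrite eq_le le/=.
have [->|a0] := eqVneq a 0; first by rewrite normr0 mul0r sup_norm_ge0.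
rewrite -ler_pdivlMl ?normr_gt0// -normfV.
by have := le a^-1 (a *: f); rewrite scalerA mulVf// scale1r.
Qed.

Lemma sup_norm0_eq0 f : sup_norm f = 0 -> f = 0.
Proof.
move=> f0; apply/contFunP => x; apply/eqP.
by rewrite contFun0E -normr_le0 -f0 le_sup_norm.
Qed.

HB.instance Definition _ := @Lmodule_isNormed.Build R (contFun R K)
  sup_norm ler_sup_normD sup_normZ sup_norm0_eq0.

Lemma contFun_normE f : `|f| = sup_norm f.
Proof. by []. Qed.

End contFun_norm.

Section contFun_complete.
Context (R : realType) (K : compactHausdorffType).

Lemma contFun_complete (F : set_system (contFun R K)) :
  ProperFilter F -> cauchy F -> cvg F.
Proof.
move=> FF /cauchyP Fc.
have Fball e (f0 f : contFun R K) :
    ball f0 e f -> forall x, `|f0 x - f x| < e.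
  rewrite -ball_normE /= contFun_normE => f0f x; apply: le_lt_trans f0f.
  by rewrite -contFunBE le_sup_norm.
pose l x : R := lim (f x @[f --> F]).
have Fl x : f x @[f --> F] --> l x.
  apply: cauchy_cvg; apply/cauchyP => e e0.
  have [f0 Ff0] := Fc e e0; exists (f0 x).
  by apply: (@filterS _ F _ _ _ _ Ff0) => f /Fball f0f; exact: f0f.
have Fu e : 0 < e -> F [set f : contFun R K | forall x, `|f x - l x| <= e].
  move=> e0; have e20 : 0 < e / 2 by rewrite divr_gt0.
  have [f0 Ff0] := Fc _ e20.
  have f0l x : `|f0 x - l x| <= e / 2.
    have f0F : `|f0 x - f x| @[f --> F] --> `|f0 x - l x|.
      by apply: cvg_norm; apply: cvgB; [exact: cvg_cst|exact: Fl].
    rewrite leNgt; apply/negP => lt.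
    have [f []] := filter_ex (@filterI _ F _ _ _ (cvgr_gt _ f0F _ lt) Ff0).
    by move=> + /Fball f0f; rewrite ltNge ltW// f0f.
  apply: (@filterS _ F _ _ _ _ Ff0) => f /Fball f0f x.
  rewrite -(subrK (f0 x) (f x)) -addrA (le_trans (ler_normD _ _))//.
  by rewrite [leRHS]splitr lerD// distrC ltW.
have lc : continuous l.
  move=> x; apply/cvgrPdist_le => e e0.
  have e30 : 0 < e / 3 by rewrite divr_gt0.
  have [f fl] := filter_ex (Fu _ e30).
  have /cvgrPdist_le/(_ _ e30) := @contFun_continuous R K f x.
  apply: filterS => y fxy.
  have -> : l x - l y = (l x - f x) + (f x - f y) + (f y - l y).
    by ring.
  have -> : e = e / 3 + e / 3 + e / 3.
    by field.
  rewrite (le_trans (ler_normD _ _))// lerD//.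
  by rewrite (le_trans (ler_normD _ _))// lerD// distrC.
apply/cvg_ex; exists (ContFun (introT (continuous_predP _) lc)).
apply/cvgrPdist_le => e e0; apply: (@filterS _ F _ _ _ _ (Fu _ e0)) => f fl.
rewrite contFun_normE; apply: sup_norm_le => [|x]; first exact: ltW.
by rewrite contFunBE distrC.
Qed.

HB.instance Definition _ := Uniform_isComplete.Build (contFun R K)
  contFun_complete.

End contFun_complete.

Section smooth.
Context (R : realType) (c : compactification nat).

Definition natural_c0 : set (contFun R c) :=
  [set f | forall x, remainder c x -> f x = 0].

Definition smooth : Prop :=
  exists P : {linear contFun R c -> contFun R c},
    [/\ exists M : R, forall f, `|P f| <= M * `|f|,
        forall f, P (P f) = P f &
        range P = natural_c0].

End smooth.

(* Main.v *)
Require Import Defs.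
From HB Require Import structures.
From mathcomp Require Import all_boot all_order all_algebra.
From mathcomp Require Import all_classical all_reals all_analysis.
Import Order.TTheory GRing.Theory Num.Theory.
Import numFieldNormedType.Exports.

(* A family of subsets of omega, together with the singletons, gives a
   compactification: the closure of omega in a Cantor cube. Split omega into
   infinite columns indexed by the finite binary words (and one spare column).
   For eta take the columns and the unions of columns along the branches x of
   the binary tree, one branch for each label t. All points of a column look
   alike, so setting the coordinates of the singletons to 0 retracts eta onto
   its remainder, and f - f \o r is a projection onto c_0. For gamma remove
   from the t-th union a set meeting every column in at most one point; this
   does not change the remainder. The removed sets diagonalize: if P projects
   C(gamma) onto c_0, put lam_n f = f n - P f n. These functionals are uniformly
   bounded and vanish on c_0, so for all but countably many labels lam_n of the
   t-th set is the sum of the values of lam_n at the columns of the branch. A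
   label records all these values (and a free real, to escape the countable
   set), so the removed set may be chosen as the first point n of every column
   of the branch where this sum exceeds 1/2. Since lam_n - delta_n tends to 0
   on every function, neither removing nor keeping points on the branch is
   possible. *)

Set Implicit Arguments.
Unset Strict Implicit.
Unset Printing Implicit Defensive.

Local Open Scope classical_set_scope.
Local Open Scope ring_scope.

(** * Basic neighbourhoods in a Cantor cube *)

Section cylinders.
Variable I : eqType.
Implicit Types (x y : {ptws I -> bool}) (J : seq I).

Definition cylinder y J : set {ptws I -> bool} :=
  [set x | forall i, i \in J -> x i = y i].

Lemma cylinder_nbhs y J : nbhs y (cylinder y J).
Proof.
elim: J => [|i J IH]; first exact: filterS filterT.
have yi : nbhs y [set x : {ptws I -> bool} | x i = y i].
  apply: (@proj_continuous I (fun=> bool) i y [set b | b = y i]).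
  by rewrite nbhs_principalE; apply/principal_filterP.
apply: filterS (filterI yi IH) => x [xi xJ] k.
by rewrite inE => /orP[/eqP->//|]; apply: xJ.
Qed.

(** Cylinders at [y] generate a filter converging in each coordinate, hence in the product topology,
    a supremum of initial topologies. *)
Lemma nbhs_cylinder y (U : set {ptws I -> bool}) :
  nbhs y U -> exists J, cylinder y J `<=` U.
Proof.
pose F := filter_from [set: seq I] (cylinder y).
have FF : Filter F.
  apply: filter_from_filter; first by exists [::].
  move=> J K _ _; exists (J ++ K) => // x xJK.
  by split=> i iJ; apply: xJK; rewrite mem_cat iJ ?orbT.
have : F --> y.
  apply/cvg_sup => i V [W [[B oB <-] /= By] WV].
  exists [:: i] => // x xy; apply: WV => /=.
  by rewrite xy// mem_head.
by move=> /[apply] -[J _ JU]; exists J.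
Qed.

End cylinders.

(** * Compact Hausdorff subspaces *)

Section subtype_compact.
Context {X : topologicalType} (A : set X).

Lemma compact_set_type : compact A -> compact [set: set_type A].
Proof.
move=> cA F FF _.
have FA : (val @ F) A by apply: nearW => x; exact: set_valP.
have [p [Ap pF]] := cA _ _ FA.
exists (exist _ p (mem_set Ap)); split=> // B U FB [V [[W oW <-] /= Wp] VU].
have [_ [[x Bx <-] Wx]] : val @` B `&` W !=set0.
  apply: pF; last by apply: open_nbhs_nbhs; split.
  by apply: (@filterS _ F _ _ _ _ FB) => x Bx; exists x.
by exists x; split=> //; apply: VU.
Qed.

Lemma hausdorff_set_type : hausdorff_space X -> hausdorff_space (set_type A).
Proof.
move=> hX p q pq; apply: val_inj; apply: hX => U V pU qV.
have cv : continuous (val : set_type A -> X) by exact: initial_continuous.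
have [x [Ux Vx]] := pq _ _ (cv p U pU) (cv q V qV).
by exists (val x).
Qed.

End subtype_compact.

(** * The compactification of omega generated by a family of sets *)

Section cube_compactification.
Context {I : eqType} (S : nat -> I -> bool).

(** [S n i] says that [n] is in the [i]-th set. The [inl] coordinates, indicators of singletons,
    isolate the points of omega. *)
Definition trace n : {ptws (nat + I)%type -> bool} :=
  fun i => match i with inl m => n == m | inr i => S n i end.

Definition cube_space : Type := set_type (closure (range trace)).

HB.instance Definition _ := Topological.on cube_space.

Lemma cube_space_compact : compact [set: cube_space].
Proof.
apply: compact_set_type.
have cT : compact [set: {ptws (nat + I)%type -> bool}].
  rewrite (_ : setT = [set f | forall i, [set: bool] (f i)]); last first.
    by apply/seteqP; split.
  exact: (@tychonoff _ (fun=> bool) _ (fun=> bool_compact)).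
exact: subclosed_compact (@closed_closure _ _) cT _.
Qed.

Lemma cube_space_hausdorff : hausdorff_space cube_space.
Proof.
apply: hausdorff_set_type; apply: hausdorff_product => i.
exact: discrete_hausdorff.
Qed.

HB.instance Definition _ :=
  isCompactHausdorff.Build cube_space cube_space_compact cube_space_hausdorff.

Lemma trace_closure n : trace n \in closure (range trace).
Proof. by apply/mem_set/subset_closure; exists n. Qed.

Definition cube_emb n : cube_space := exist _ (trace n) (trace_closure n).

Lemma continuous_coord i : continuous (fun x : cube_space => val x i).
Proof.
move=> x; apply: (@continuous_comp _ _ _ (val : cube_space -> _) (proj i)).
  exact: initial_continuous.
exact: proj_continuous.
Qed.

Lemma open_coord i b : open [set x : cube_space | val x i = b].
Proof.
have /continuousP := @continuous_coord i.
by move=> /(_ [set b]); apply; exact: discrete_open.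
Qed.

Lemma coord_inl (x : cube_space) n : val x (inl n) -> x = cube_emb n.
Proof.
move=> xn; apply: val_inj; apply/funext => i /=.
(* A trace [m] agreeing with [x] at [inl n] has [m] equal to [n]; agreement at [i] then settles the
   value there. *)
have := set_valP x => /(_ _ (cylinder_nbhs (val x) [:: inl n; i])).
move=> [_ [[m _ <-] xm]].
have := xm (inl n); rewrite mem_head xn /= => /(_ isT)/eqP <-.
by rewrite -xm// !inE eqxx orbT.
Qed.

Lemma cube_emb_inj : injective cube_emb.
Proof.
by move=> m n /(congr1 (fun x => val x (inl m)))/=; rewrite eqxx => /esym/eqP.
Qed.

Lemma cube_emb_open (A : set nat) :
  open A <-> exists2 B : set cube_space, open B & cube_emb @^-1` B = A.
Proof.
split=> [_|_]; last exact: discrete_open.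
exists (\bigcup_(n in A) [set x : cube_space | val x (inl n) = true]).
  by apply: bigcup_open => n _; exact: open_coord.
apply/seteqP; split=> [n [m Am /= /eqP->]//|n An]; exists n => //=.
exact: eqxx.
Qed.

Lemma cube_emb_dense : dense (range cube_emb).
Proof.
move=> U [x Ux] [V oV VU]; rewrite -VU in Ux.
have [_ [[n _ <-] Vn]] := set_valP x _ (open_nbhs_nbhs (conj oV Ux)).
by exists (cube_emb n); split; [rewrite -VU|exists n].
Qed.

Definition cube_cpt : compactification nat :=
  Compactification cube_emb_inj cube_emb_open cube_emb_dense.

Lemma remainderP (x : cube_cpt) :
  remainder cube_cpt x <-> forall n, val x (inl n) = false.
Proof.
split=> [xr n|x0 [n _ xn]]; last first.
  by have := x0 n; rewrite -xn /= eqxx.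
by apply/negbTE/negP => /coord_inl xn; apply: xr; exists n.
Qed.

End cube_compactification.

(** * The remainder in coordinates *)

Section remainders.
Context {I : eqType}.
Implicit Types (S : nat -> I -> bool) (z : I -> bool).

(** Such [z] are the cluster points of the rows [S n]; extended by [false] on the singletons, they
    are exactly the points of the remainder. *)
Definition recurs S z :=
  forall (J : seq I) N,
    exists2 n, (N <= n)%N & forall i, i \in J -> S n i = z i.

Lemma recurs_remainder S (x : cube_cpt S) :
  remainder (cube_cpt S) x -> recurs S (fun i => val x (inr i)).
Proof.
move=> /remainderP x0 J N.
(* The value [false] at the singletons below [N] forces the approximating [n] to be at least [N]. *)
pose K := map inl (iota 0 N) ++ map inr J : seq (nat + I).
have [_ [[n _ <-] nx]] := set_valP x _ (cylinder_nbhs (val x) K).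
exists n => [|i iJ]; last first.
  by apply: (nx (inr i)); rewrite mem_cat map_f ?orbT.
rewrite leqNgt; apply/negP => nN; have := nx (inl n).
by rewrite mem_cat map_f ?mem_iota//= => /(_ isT); rewrite eqxx x0.
Qed.

Lemma recurs_closure S (y : {ptws (nat + I)%type -> bool}) :
  (forall n, y (inl n) = false) -> recurs S (fun i => y (inr i)) ->
  closure (range (trace S)) y.
Proof.
move=> y0 Sy U /nbhs_cylinder[J JU].
have [N JN] : exists N, forall n, inl n \in J -> (n < N)%N.
  elim: J {JU} => [|[m|i] J [N IH]]; first by exists 0%N.
    exists (maxn m.+1 N) => n; rewrite inE leq_max => /orP[/eqP[->]|/IH ->].
      by rewrite leqnn.
    by rewrite orbT.
  by exists N => n; rewrite inE => /orP[//|/IH].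
have [n Nn nJ] := Sy (pmap (fun i => if i is inr j then Some j else None) J) N.
exists (trace S n); split; first by exists n.
apply: JU => -[m|i] iJ /=.
  by rewrite y0; apply/gtn_eqF/(leq_trans (JN _ iJ) Nn).
by apply: nJ; rewrite mem_pmap; apply/mapP; exists (inr i).
Qed.

Lemma remainder_transfer S S' :
  (forall z, recurs S z -> recurs S' z) ->
  exists2 f : set_type (remainder (cube_cpt S)) ->
              set_type (remainder (cube_cpt S')),
    continuous f & forall x, val (val (f x)) = val (val x).
Proof.
move=> SS'.
have cl (x : set_type (remainder (cube_cpt S))) :
    val (val x) \in closure (range (trace S')).
  apply/mem_set/recurs_closure;
    first exact: ((remainderP _).1 (set_valP x)).
  exact/SS'/(recurs_remainder (set_valP x)).
pose g x : cube_cpt S' := exist _ (val (val x)) (cl x).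
have gr x : g x \in remainder (cube_cpt S').
  by apply/mem_set/remainderP; exact: ((remainderP _).1 (set_valP x)).
exists (fun x => exist _ (g x) (gr x)) => //.
apply: continuous_comp_initial; apply: continuous_comp_initial => x.
apply: (@continuous_comp _ _ _
  (val : set_type (remainder (cube_cpt S)) -> cube_cpt S)
  (val : cube_cpt S -> _)); exact: initial_continuous.
Qed.

Lemma remainder_homeomorphic S S' :
  (forall z, recurs S z <-> recurs S' z) ->
  homeomorphic (set_type (remainder (cube_cpt S)))
               (set_type (remainder (cube_cpt S'))).
Proof.
move=> SS'.
have [f cf fE] := @remainder_transfer S S' (fun z => (SS' z).1).
have [g cg gE] := @remainder_transfer S' S (fun z => (SS' z).2).
by exists f, g; split=> // x; apply/val_inj/val_inj; rewrite ?(gE, fE).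
Qed.

(** * Smoothness from a retraction onto the remainder *)

Section retraction.
Context (R : realType) (S : nat -> I -> bool).
Hypothesis SS : forall n, recurs S (S n).

Let zero_out (y : {ptws (nat + I)%type -> bool}) : {ptws (nat + I)%type -> bool}
  := fun i => if i is inl _ then false else y i.

Let zero_out_continuous : continuous zero_out.
Proof.
move=> y U /nbhs_cylinder[J JU].
apply: filterS (cylinder_nbhs y J) => x xy; apply: JU => -[//|i] iJ /=.
exact: xy.
Qed.

(** A trace [m] close to [x] has a recurring row, so arbitrarily late points approximate the [inr]
    coordinates of [x]. *)
Let zero_out_closure (x : cube_cpt S) :
  zero_out (val x) \in closure (range (trace S)).
Proof.
apply/mem_set/recurs_closure => //= J N.
have [_ [[m _ <-] xm]] :=
  set_valP x _ (cylinder_nbhs (val x) (map inr J : seq (nat + I))).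
have [n Nn nm] := SS m J N; exists n => // i iJ; rewrite nm//.
by rewrite -(xm (inr i))// map_f.
Qed.

Let retract (x : cube_cpt S) : cube_cpt S :=
  exist _ (zero_out (val x)) (zero_out_closure x).

Let retract_continuous : continuous retract.
Proof.
apply: continuous_comp_initial => x.
apply: (@continuous_comp _ _ _ (val : cube_cpt S -> _) zero_out).
  exact: initial_continuous.
exact: zero_out_continuous.
Qed.

Let retract_remainder x : remainder (cube_cpt S) (retract x).
Proof. exact/remainderP. Qed.

Let retract_id x : remainder (cube_cpt S) x -> retract x = x.
Proof.
by move=> /remainderP x0; apply/val_inj/funext => -[n|i] //=; rewrite x0.
Qed.

Let comp_retract_mem (f : contFun R (cube_cpt S)) :
  f \o retract \in continuous_pred.
Proof.
apply/continuous_predP => x; apply: continuous_comp.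
  exact: retract_continuous.
exact: contFun_continuous.
Qed.

Let proj_c0 (f : contFun R (cube_cpt S)) := f - ContFun (comp_retract_mem f).

Let proj_c0E f x : proj_c0 f x = f x - f (retract x).
Proof. by []. Qed.

Let proj_c0_linear : linear proj_c0.
Proof.
move=> a f g; apply/contFunP => x.
rewrite proj_c0E !contFunDE !contFunZE !proj_c0E.
by rewrite mulrBr opprD addrACA.
Qed.

HB.instance Definition _ :=
  GRing.isLinear.Build R _ _ _ proj_c0 proj_c0_linear.

Lemma recurs_smooth : smooth R (cube_cpt S).
Proof.
have Pc0 f : natural_c0 (proj_c0 f).
  by move=> x xr; rewrite proj_c0E retract_id ?subrr.
have Pid f : natural_c0 f -> proj_c0 f = f.
  move=> f0; apply/contFunP => x; rewrite proj_c0E.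
  have -> : f (retract x) = 0 by apply: f0; exact: retract_remainder.
  by rewrite subr0.
exists proj_c0; split.
- exists 2 => f; rewrite !contFun_normE; apply: sup_norm_le => [|x].
    by rewrite mulr_ge0 ?sup_norm_ge0.
  by rewrite proj_c0E (le_trans (ler_normB _ _))//
    mulr2n mulrDl mul1r lerD ?le_sup_norm.
- by move=> f; apply: Pid; exact: Pc0.
- apply/seteqP; split=> [_ [f _ <-]|f f0]; first exact: Pc0.
  by exists f => //; exact: Pid.
Qed.

End retraction.
End remainders.

(** * Elements of c_0 as null sequences *)

Section c0.
Context (R : realType) (c : compactification nat).
Implicit Type f : contFun R c.

Lemma sup_norm_dense f M :
  0 <= M -> (forall n, `|f (cpt_emb c n)| <= M) -> `|f| <= M.
Proof.
move=> M0 fM; rewrite contFun_normE; apply: sup_norm_le => // x.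
rewrite leNgt; apply/negP => xM.
have oU : open ((fun y => `|f y|) @^-1` [set r | M < r]).
  apply: open_comp; last exact: open_gt.
  by move=> y _; apply: cvg_norm; exact: contFun_continuous.
have [y [/= fy [n _ nE]]] := @cpt_emb_dense _ c _ (ex_intro _ x xM) oU.
by have := fM n; rewrite nE leNgt fy.
Qed.

(** Otherwise the tails of the set where [f] has absolute value at least [e] cluster at some [p], by
    compactness. It is not in omega, whose points are isolated, nor in the remainder, where [f]
    vanishes. *)
Lemma natural_c0_cvg f e : natural_c0 f -> 0 < e ->
  \forall n \near \oo, `|f (cpt_emb c n)| < e.
Proof.
move=> f0 e0; apply: contrapT => nfe.
pose D := filter_from [set: nat]
  (fun N =>
    [set cpt_emb c n | n in [set n | (N <= n)%N /\ e <= `|f (cpt_emb c n)|]]).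
have FD : ProperFilter D.
  apply: filter_from_proper; last first.
    move=> N _; apply: contrapT => nD; apply: nfe; exists N => // n Nn.
    rewrite /= ltNge; apply/negP => fn; apply: nD.
    by exists (cpt_emb c n), n.
  apply: filter_from_filter; first by exists 0%N.
  move=> N M _ _; exists (maxn N M) => // _ [n [NMn fn] <-].
  by move: NMn; rewrite geq_max => /andP[Nn Mn]; split; exists n.
have [p [_ pD]] := @compactT c D FD filterT.
have DN N :
  D [set cpt_emb c n | n in [set n | (N <= n)%N /\ e <= `|f (cpt_emb c n)|]].
  by exists N.
have [[m _ mp]|pr] := pselect (range (cpt_emb c) p).
  have [B oB BE] := (cpt_emb_open c [set m]).1 (discrete_open _).
  have pB : nbhs p B.
    apply: open_nbhs_nbhs; split=> //; rewrite -mp.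
    by have : (cpt_emb c @^-1` B) m by rewrite BE.
  have [_ [[n [mn _] <-] Bn]] := pD _ _ (DN m.+1) pB.
  have : (cpt_emb c @^-1` B) n by [].
  by rewrite BE /= => nm; rewrite nm ltnn in mn.
have fp : nbhs p [set x | `|f x| < e].
  have : f x @[x --> p] --> (0 : R).
    by rewrite -(f0 _ pr); exact: contFun_continuous.
  by move=> /cvgr0Pnorm_lt/(_ e e0).
have [_ [[n [_ fn] <-] /= fnlt]] := pD _ _ (DN 0%N) fp.
by rewrite ltNge fn in fnlt.
Qed.

End c0.

(** * Continuous indicators of the generating sets *)

Section coordinate_functions.
Context (R : realType) {I : eqType} (S : nat -> I -> bool).

Lemma coord_mem i :
  (fun x : cube_cpt S => (val x i)%:R : R) \in continuous_pred.
Proof.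
apply/continuous_predP => x.
apply: (@continuous_comp _ _ _ (fun x : cube_cpt S => val x i)
  (fun b : bool => b%:R : R)).
  exact: continuous_coord.
by move=> U /nbhs_singleton; rewrite /= nbhs_principalE => ?;
  exact/principal_filterP.
Qed.

Definition coord i : contFun R (cube_cpt S) := ContFun (coord_mem i).

Lemma coord_emb_inr i n : coord (inr i) (cube_emb S n) = (S n i)%:R.
Proof. by []. Qed.

Lemma coord_inl_c0 n : natural_c0 (coord (inl n)).
Proof. by move=> x /remainderP /(_ n) xn; rewrite /= xn. Qed.

End coordinate_functions.

(** * The functionals attached to a projection onto c_0 *)

Section residual_functional.
Context (R : realType) {I : eqType} (S : nat -> I -> bool).
Implicit Type f : contFun R (cube_cpt S).
Context (P : {linear contFun R (cube_cpt S) -> contFun R (cube_cpt S)}) (M : R).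
Hypothesis PM : forall f, `|P f| <= M * `|f|.
Hypothesis PP : forall f, P (P f) = P f.
Hypothesis Prange : range P = natural_c0 (R := R) (c := cube_cpt S).

Definition residual n (f : contFun R (cube_cpt S)) : R :=
  f (cube_emb S n) - P f (cube_emb S n).

Lemma residual_linear n : linear_for *%R (residual n).
Proof.
move=> a f g; rewrite /residual linearP !contFunDE !contFunZE.
by rewrite mulrBr opprD addrACA.
Qed.

HB.instance Definition _ n :=
  GRing.isLinear.Build R _ _ _ (residual n) (residual_linear n).

Lemma residual_c0 n f : natural_c0 f -> residual n f = 0.
Proof. by rewrite -Prange => -[g _ <-]; rewrite /residual PP subrr. Qed.

Lemma residual_cvg f e : 0 < e ->
  \forall n \near \oo, `|f (cube_emb S n) - residual n f| < e.
Proof.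
move=> e0; have Pf : natural_c0 (P f) by rewrite -Prange; exists f.
by apply: filterS (natural_c0_cvg Pf e0) => n; rewrite /residual subKr.
Qed.

(** Subtracting [h] in c_0, which copies [f] at the points below [N], keeps the residual and brings
    the norm down to at most 1. The sign of [M] is unknown, hence its absolute value. *)
Lemma residual_le n f : (\forall k \near \oo, `|f (cube_emb S k)| <= 1) ->
  `|residual n f| <= 1 + `|M|.
Proof.
move=> [N _ fN].
pose h := \sum_(k < N) f (cube_emb S k) *: coord R S (inl (val k)).
have hc0 : natural_c0 h.
  move=> x xr; rewrite /h; elim/big_ind: _ => [//|a b a0 b0|k _].
    by rewrite contFunDE a0 b0 addr0.
  by rewrite contFunZE (coord_inl_c0 R (val k) xr) mulr0.
have hE k : h (cube_emb S k) = if (k < N)%N then f (cube_emb S k) else 0.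
  have -> : h (cube_emb S k) = \sum_(i < N) f (cube_emb S i) * (k == i)%:R.
    exact: (big_morph (fun g : contFun R (cube_cpt S) => g (cube_emb S k))
      (fun _ _ => erefl) erefl).
  have [kN|Nk] := ltnP k N.
    rewrite (bigD1 (Ordinal kN))//= eqxx mulr1 big1 ?addr0// => i.
    by rewrite -val_eqE eq_sym /= => /negbTE ->; rewrite mulr0.
  by rewrite big1// => i _; rewrite gtn_eqF ?mulr0// (leq_trans (ltn_ord i)).
have -> : residual n f = residual n (f - h).
  by rewrite linearB /= (residual_c0 _ hc0) subr0.
have fh1 : `|f - h| <= 1.
  apply: sup_norm_dense => // k; rewrite contFunBE /= hE.
  by case: ltnP => kN; [rewrite subrr normr0|rewrite subr0 fN].
rewrite (le_trans (ler_normB _ _))// lerD//.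
  by rewrite (le_trans _ fh1)// contFun_normE le_sup_norm.
apply: le_trans (le_sup_norm _ _) _; apply: le_trans (PM _) _.
rewrite (le_trans (ler_norm _))// normrM normr_id.
by rewrite ler_piMr.
Qed.

End residual_functional.

Lemma near_all_in (T : eqType) (J : seq T) (P : T -> nat -> Prop) :
  (forall i, i \in J -> \forall n \near \oo, P i n) ->
  \forall n \near \oo, forall i, i \in J -> P i n.
Proof.
elim: J => [_|i J IH JP]; first exact: nearW.
have PJ := IH (fun k kJ => JP k (@mem_behead _ (i :: J) k kJ)).
apply: filterS (filterI (JP i (mem_head _ _)) PJ) => n [iP nJ] k.
by rewrite inE => /orP[/eqP->//|/nJ].
Qed.

(** * Columns of omega and branches of the binary tree *)

Section columns.

(** The 2-adic valuation of [n] codes its column. The spare column [None] also absorbs valuations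
    that decode to nothing. *)
Definition column n : option (seq bool) :=
  obind id (unpickle (logn 2 n) : option (option (seq bool))).

Lemma column_infinite c N : exists2 n, (N <= n)%N & column n = c.
Proof.
(* The second factor is odd, so the valuation is exactly [pickle c]. *)
exists (2 ^ pickle c * N.*2.+1)%N; last first.
  rewrite /column lognM ?expn_gt0// pfactorK// [logn 2 _.+1]lognE.
  by rewrite dvdn2 -[odd _.+1]/(~~ odd _) odd_double !andbF addn0 pickleK.
apply: leq_trans (leq_pmull _ _); last by rewrite expn_gt0.
by rewrite -addnn -addnS leq_addr.
Qed.

Definition in_branch (x : nat -> bool) (c : option (seq bool)) :=
  if c is Some s then s == mkseq x (size s) else false.

Lemma in_branch_mkseq x l : in_branch x (Some (mkseq x l)).
Proof. by rewrite /= size_mkseq. Qed.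

Lemma in_branchP x c : reflect (exists l, c = Some (mkseq x l)) (in_branch x c).
Proof.
apply: (iffP idP) => [|[l ->]]; last exact: in_branch_mkseq.
by case: c => //= s /eqP ->; exists (size s).
Qed.

Lemma branch_almost_disjoint x y : x <> y ->
  exists l0, forall l, (l0 <= l)%N -> ~~ in_branch y (Some (mkseq x l)).
Proof.
move=> xy; have [i xyi] : exists i, x i <> y i.
  by apply/existsNP => xy'; apply: xy; exact/funext.
exists i.+1 => l il; rewrite /= size_mkseq;
  apply/eqP => /(congr1 (nth false ^~ i)).
by rewrite !nth_mkseq.
Qed.

(** Each of the finitely many points below [N] lies in one column only, so all long enough prefixes
    avoid them. *)
Lemma branch_beyond x N :
  exists l, forall n, column n = Some (mkseq x l) -> (N <= n)%N.
Proof.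
have : \forall l \near \oo, forall n, n \in iota 0 N ->
    column n <> Some (mkseq x l).
  apply: near_all_in => n _;
    exists (if column n is Some s then size s else 0).+1 => //.
  by move=> l /= + nl; rewrite nl size_mkseq ltnn.
move=> /(@filter_ex _ \oo _)[l lN]; exists l => n nl.
by rewrite leqNgt; apply/negP => nN; apply: (lN n) nl; rewrite mem_iota.
Qed.

End columns.

(** * Removing points from branches without changing the remainder *)

Section branch_family.
Context (T : eqType) (code : T -> nat -> bool).
Hypothesis code_inj : injective code.
Implicit Types (F : nat -> T -> bool) (t : T).

(** [F n t] marks [n] as removed from the union of columns for [t]. *)
Definition branch_family F n (i : seq bool + T) : bool :=
  match i with
  | inl s => column n == Some s
  | inr t => in_branch (code t) (column n) && ~~ F n t
  end.

Definition thin F := forall t c,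
  \forall n \near \oo, column n = c -> ~~ F n t.

Let F0 : nat -> T -> bool := fun _ _ => false.

Lemma branch_family_recurs n :
  recurs (branch_family F0) (branch_family F0 n).
Proof.
move=> J N; have [m Nm mn] := column_infinite (column n) N.
by exists m => // -[s|t] _ /=; rewrite mn.
Qed.

Lemma thin_column F : thin F -> forall c (J : seq (seq bool + T)),
  \forall n \near \oo, column n = c ->
    forall i, i \in J -> branch_family F n i = branch_family F0 n i.
Proof.
move=> Fthin c J.
have : \forall n \near \oo, forall i, i \in J ->
    column n = c -> branch_family F n i = branch_family F0 n i.
  apply: near_all_in => -[s|t] _; first exact: nearW.
  by apply: filterS (Fthin t c) => n nF nc /=; rewrite nF.
by apply: filterS => n nJ nc i iJ; exact: nJ.
Qed.

(* Far out, a point removed from one branch belongs to no other branch and to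
   no prescribed column, so that it looks like a point of column [None]. *)
Lemma thin_removed F : thin F -> forall J : seq (seq bool + T),
  \forall n \near \oo,
    (exists2 t, inr t \in J & in_branch (code t) (column n) && F n t) ->
    forall i, i \in J -> branch_family F n i = false.
Proof.
move=> Fthin J.
pose removed t n := in_branch (code t) (column n) && F n t.
have : \forall n \near \oo, forall i, i \in J -> forall j, j \in J ->
    if i is inr t then removed t n -> branch_family F n j = false else True.
  apply: near_all_in => -[s|t] iJ; first exact: nearW.
  apply: near_all_in => -[s|u] jJ /=.
    apply: filterS (Fthin t (Some s)) => n nF /andP[_ Fnt].
    by apply/negbTE/eqP => /nF; rewrite Fnt.
  have [<-|tu] := eqVneq t u.
    by apply: nearW => n /andP[_ ->]; rewrite andbF.
  (* The two branches share no column of level [l0] or more; in the columns below, thinness excludes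
     removed points far out. *)
  have [l0 l0P] : exists l0, forall l, (l0 <= l)%N ->
      ~~ in_branch (code u) (Some (mkseq (code t) l)).
    by apply: branch_almost_disjoint => /code_inj; exact/eqP.
  have : \forall n \near \oo, forall l, l \in iota 0 l0 ->
      column n = Some (mkseq (code t) l) -> ~~ F n t.
    by apply: near_all_in => l _; exact: Fthin.
  apply: filterS => n nl /andP[/in_branchP[l nE] Fnt].
  rewrite nE; have [ll0|/l0P/negbTE->//] := ltnP l l0.
  by have := nl l; rewrite mem_iota ll0 nE Fnt => /(_ isT erefl).
apply: filterS => n nJ [t tJ nt] i iJ.
by have := nJ _ tJ _ iJ => /(_ nt).
Qed.

Lemma branch_family_recursE F z : thin F ->
  recurs (branch_family F) z <-> recurs (branch_family F0) z.
Proof.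
move=> Fthin; split=> Sz J N.
  have [N1 _ N1P] := thin_removed Fthin J.
  have [n] := Sz J (maxn N N1); rewrite geq_max => /andP[Nn N1n] nz.
  (* If [n] is removed from a branch in [J], then [z] vanishes on [J] and the spare column realizes
     it; otherwise both families agree on [J] at [n]. *)
  have [/(N1P _ N1n) n0|nr] := pselect (exists2 t, inr t \in J &
      in_branch (code t) (column n) && F n t).
    have [m Nm mN] := column_infinite None N; exists m => // i iJ.
    by rewrite -nz// n0//; case: i {iJ} => [s|t] /=; rewrite mN.
  exists n => // -[s|t] iJ; rewrite -nz//= andbT.
  case bt: in_branch => //=; case Fnt: (F n t) => //.
  by case: nr; exists t => //; rewrite bt Fnt.
(* Conversely, move from [n] to a point of the same column beyond those removed for [J]. *)
have [n _ nz] := Sz J 0%N.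
have [N1 _ N1P] := thin_column Fthin (column n) J.
have [m] := column_infinite (column n) (maxn N N1).
rewrite geq_max => /andP[Nm N1m] mn; exists m => // i iJ.
by rewrite N1P// -nz//; case: i {iJ} => [s|t] /=; rewrite mn.
Qed.

End branch_family.

(** * Countably many exceptional labels *)

Section residual_tails.
Context (R : realType) (T : eqType) (code : T -> nat -> bool).
Hypothesis code_inj : injective code.
Context (F : nat -> T -> bool).
Hypothesis Fthin : thin F.
Implicit Type t : T.

Local Notation S := (branch_family code F).
Local Notation K := (cube_cpt S).

(** On omega this is 1 at the kept points of the branch from level [j] on, -1 at the removed points
    of its levels below [j], and 0 elsewhere. *)
Definition tail t j : contFun R K :=
  coord R S (inr (inr t)) -
  \sum_(l < j) coord R S (inr (inl (mkseq (code t) l))).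

Lemma sum_contFunE (q : nat) (f : 'I_q -> contFun R K) x :
  (\sum_(i < q) f i) x = \sum_(i < q) f i x.
Proof.
exact: (big_morph (fun g : contFun R K => g x) (fun _ _ => erefl) erefl).
Qed.

Lemma tail_emb t j n : tail t j (cube_emb S n) = 0 \/
  exists l, [/\ column n = Some (mkseq (code t) l), (j <= l)%N || F n t &
    `|tail t j (cube_emb S n)| <= 1].
Proof.
have -> : tail t j (cube_emb S n) = (S n (inr t))%:R -
    \sum_(l < j) (column n == Some (mkseq (code t) l))%:R.
  by rewrite /tail contFunBE sum_contFunE.
have [/in_branchP[l nl]|ntb] := boolP (in_branch (code t) (column n));
  last first.
  left; rewrite /= (negbTE ntb) sub0r big1 ?oppr0// => l _.
  by case: eqP ntb => // ->; rewrite in_branch_mkseq.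
have -> :
  \sum_(i < j) (column n == Some (mkseq (code t) i))%:R = (l < j)%:R :> R.
  have E i : (column n == Some (mkseq (code t) i)) = (i == l).
    apply/eqP/eqP => [|->//]; rewrite nl => -[] /(congr1 size).
    by rewrite !size_mkseq.
  have [lj|jl] := ltnP l j.
    rewrite (bigD1 (Ordinal lj))//= E eqxx big1 ?addr0// => i il.
    by rewrite E; have -> : (i == l :> nat) = false by exact: negbTE.
  by rewrite big1// => i _; rewrite E ltn_eqF// (leq_trans (ltn_ord i)).
rewrite /= nl in_branch_mkseq /=.
case: ltnP => lj; case: (F n t) => /=; rewrite ?subrr ?subr0 ?sub0r.
- by right; exists l; split; rewrite ?orbT ?normrN ?normr1.
- by left.
- by left.
- by right; exists l; split; rewrite ?lj ?normr1.
Qed.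

(* The functions [tail] of finitely many points have almost disjoint supports
   if they are cut far enough. *)
Lemma sum_tail_le1 q (ts : nat -> T) : injective ts ->
  exists j0, forall (j : nat -> nat) (a : nat -> R),
    (forall i, (j0 <= j i)%N) -> (forall i, `|a i| <= 1) ->
    \forall n \near \oo,
      `|(\sum_(i < q) a i *: tail (ts i) (j i)) (cube_emb S n)| <= 1.
Proof.
move=> ts_inj.
have [j0 _ j0P] : \forall l \near \oo, forall i, i \in iota 0 q ->
    forall k, k \in iota 0 q -> i != k ->
    ~~ in_branch (code (ts k)) (Some (mkseq (code (ts i)) l)).
  apply: near_all_in => i _; apply: near_all_in => k _.
  have [->|ik] := eqVneq i k; first exact: nearW.
  have [l0 l0P] : exists l0, forall l, (l0 <= l)%N ->
      ~~ in_branch (code (ts k)) (Some (mkseq (code (ts i)) l)).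
    by apply: branch_almost_disjoint => /code_inj/ts_inj; exact/eqP.
  by exists l0 => // l /l0P.
exists j0 => j a jj0 a1.
(* Far out, no removed point sits at a level below [j0] of its branch, so a nonzero tail puts [n] at
   level [j0] or more. *)
have : \forall n \near \oo, forall i, i \in iota 0 q ->
    forall l, l \in iota 0 j0 -> column n = Some (mkseq (code (ts i)) l) ->
    ~~ F n (ts i).
  by apply: near_all_in => i _; apply: near_all_in => l _; exact: Fthin.
apply: filterS => n nF; rewrite sum_contFunE.
have supp (i : 'I_q) : tail (ts i) (j i) (cube_emb S n) != 0 ->
    exists2 l, column n = Some (mkseq (code (ts i)) l) & (j0 <= l)%N.
  case: (tail_emb (ts i) (j i) n) => [->|[l [nl jlF _]] _];
    first by rewrite eqxx.
  exists l => //; rewrite leqNgt; apply/negP => lj0.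
  have iq : val i \in iota 0 q by rewrite mem_iota ltn_ord.
  have := nF _ iq l; rewrite mem_iota lj0 => /(_ isT nl)/negbTE Fn.
  move: jlF; rewrite Fn orbF => /(leq_trans (jj0 i)).
  by rewrite leqNgt lj0.
have le1 t m : `|tail t m (cube_emb S n)| <= 1.
  by case: (tail_emb t m n) => [->|[l [_ _ //]]]; rewrite normr0.
have [[i i0]|nex] :=
  pselect (exists i : 'I_q, tail (ts i) (j i) (cube_emb S n) != 0);
  last first.
  rewrite big1 ?normr0// => i _; rewrite contFunZE.
  have [->|i0] := eqVneq (tail (ts i) (j i) (cube_emb S n)) 0;
    first by rewrite mulr0.
  by case: nex; exists i.
(* From level [j0] on the branches are disjoint, so only the summand [i] survives. *)
rewrite (bigD1 i)// big1 => [|k /andP[_ ki]].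
  by rewrite [X in `|X|]addr0 contFunZE normrM mulr_ile1.
rewrite contFunZE.
have [->|k0] := eqVneq (tail (ts k) (j k) (cube_emb S n)) 0;
  first by rewrite mulr0.
have [l nl j0l] := supp _ i0; have [l' nl' _] := supp _ k0.
have := j0P l j0l i _ k _; rewrite !mem_iota !ltn_ord => /(_ isT isT).
by rewrite eq_sym -nl nl' in_branch_mkseq => /(_ ki).
Qed.

Context (P : {linear contFun R K -> contFun R K}) (M : R).
Hypothesis PM : forall f, `|P f| <= M * `|f|.
Hypothesis PP : forall f, P (P f) = P f.
Hypothesis Prange : range P = natural_c0 (R := R) (c := K).

(** Given infinitely many such labels, a signed sum of [q] tails, cut far enough, is eventually
    bounded by 1 but has residual at least [q] times [e], which exceeds [1 + |M|]. *)
Lemma finite_residual_tail n (e : R) : 0 < e -> finite_set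
  [set t | forall j0, exists2 j, (j0 <= j)%N & e <= `|residual P n (tail t j)|].
Proof.
move=> e0; apply: contrapT => /infiniteP/card_leP[g].
pose ts i : T := val (g (exist _ i (mem_set I))).
have ts_inj : injective ts.
  by move=> i k /val_inj ik;
    have [] := @inj _ _ _ g _ _ (mem_set I) (mem_set I) ik.
pose q := (Num.truncn ((1 + `|M|) / e)).+1.
have [j0 j0P] := sum_tail_le1 q ts_inj.
have /choice[j jP] : forall i, exists j, (j0 <= j)%N /\
    e <= `|residual P n (tail (ts i) j)|.
  by move=> i; have [j j0j ej] := set_valP (g (exist _ i (mem_set I))) j0;
    exists j.
pose a i := Num.sg (residual P n (tail (ts i) (j i))).
have a1 i : `|a i| <= 1 by rewrite normr_sg; case: eqP => //=; rewrite ler01.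
have := residual_le PM PP Prange n (j0P j a (fun i => (jP i).1) a1).
apply/negP; rewrite -ltNge.
rewrite (@lt_le_trans _ _ (q%:R * e))//.
  by rewrite -ltr_pdivrMr// truncnS_gt.
rewrite linear_sum (le_trans _ (ler_norm _))// mulr_natl -[q in leLHS]card_ord.
rewrite -sumr_const; apply: ler_sum => i _.
by rewrite linearZ /= /a -normrEsg (jP i).2.
Qed.

(** Each failure of convergence is witnessed by some [n] and some threshold [1 / (r + 1)], and each
    such pair admits finitely many labels. *)
Lemma countable_residual_tail : countable
  [set t | ~ forall n, residual P n (tail t j) @[j --> \oo] --> (0 : R)].
Proof.
pose B n r := [set t | forall j0, exists2 j, (j0 <= j)%N &
  r.+1%:R^-1 <= `|residual P n (tail t j)|].
apply: (@sub_countable _ _ _ (\bigcup_(nr in [set: nat * nat]) B nr.1 nr.2)).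
  apply: subset_card_le => t /= /existsNP[n nt].
  apply: contrapT => tB; apply: nt; apply/cvgr0Pnorm_lt => e e0.
  apply: contrapT => nte; apply: tB.
  pose r := Num.truncn e^-1.
  exists (n, r) => // j0; apply: contrapT => nj; apply: nte;
    exists j0 => // j /= j0j.
  rewrite ltNge; apply/negP => ej; apply: nj; exists j => //.
  apply: le_trans ej; rewrite invf_ple ?posrE//.
  by apply: ltW; rewrite truncnS_gt.
apply: bigcup_countable => // nr _; apply: finite_set_countable.
by apply: finite_residual_tail; rewrite invr_gt0.
Qed.

Lemma residual_tailE n t j : residual P n (tail t j) =
  residual P n (coord R S (inr (inr t))) -
  \sum_(l < j) residual P n (coord R S (inr (inl (mkseq (code t) l)))).
Proof. by rewrite linearB linear_sum. Qed.

End residual_tails.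

Lemma uncountable_binary : ~ countable [set: nat -> bool].
Proof.
move=> /pcard_injP[f fI].
have f_inj : injective f by move=> x y; apply: fI; rewrite inE.
(* Cantor's diagonal: [d] differs from every [x] at the index [f x], hence from itself. *)
pose d n := `[< exists2 x : nat -> bool, f x = n & x n = false >].
case dE : (d (f d)).
  have /asboolP[x /f_inj xd] : d (f d) by rewrite dE.
  by rewrite xd dE.
by have /asboolP[] : ~~ d (f d); [rewrite dE|exists d].
Qed.

(** * Diagonalization against all projections *)

Section diagonal.
Context (R : realType).

(* The first component lists the masses that a sequence of functionals gives
   to the columns, the second provides uncountably many branches for each such
   list. *)
Definition label := ((nat -> seq bool -> R) * (nat -> bool))%type.
Implicit Type t : label.

(** A real is recorded by the rationals above it, so both components of a label fit into one binary
    sequence. *)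
Definition code t (m : nat) : bool :=
  match unpickle m : option (nat * seq bool * rat + nat) with
  | Some (inl (n, s, q)) => t.1 n s < ratr q
  | Some (inr i) => t.2 i
  | None => false
  end.

Lemma code_inj : injective code.
Proof.
move=> [u x] [v y] uv.
have {}uv (m : nat * seq bool * rat + nat) :
    code (u, x) (pickle m) = code (v, y) (pickle m) by rewrite uv.
congr pair; last first.
  by apply/funext => i; have := uv (inr i); rewrite /code !pickleK.
apply/funext => n; apply/funext => s; apply/eqP.
have cut q : (u n s < ratr q) = (v n s < ratr q).
  by have := uv (inl (n, s, q)); rewrite /code !pickleK.
rewrite eq_le; apply/andP; split; rewrite leNgt; apply/negP => /rat_in_itvoo[q].
  by rewrite in_itv/= => /andP[vq /ltW]; rewrite leNgt cut vq.
by rewrite in_itv/= => /andP[uq /ltW]; rewrite leNgt -cut uq.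
Qed.

(** The masses are read off the label, so the removed sets are fixed before any projection is given.
    If the series diverges, the value is a default one. *)
Definition branch_mass n t : R :=
  lim ((\sum_(l < j) t.1 n (mkseq (code t) l)) @[j --> \oo]).

Definition removed n t : bool :=
  (1 / 2 < branch_mass n t) &&
  [forall m : 'I_n, (column m == column n) ==> (branch_mass m t <= 1 / 2)].

Lemma removed_thin : thin removed.
Proof.
move=> t c.
have [[m mc mr]|nex] := pselect (exists2 m, column m = c & removed m t);
  last first.
  by apply: nearW => n nc; apply/negP => nr; apply: nex; exists n.
exists m.+1 => // n /= mn nc; apply/negP => /andP[_ /forallP/(_ (Ordinal mn))].
by rewrite /= mc nc eqxx /= leNgt; case/andP: mr => ->.
Qed.

Lemma removed_exists n t : 1 / 2 < branch_mass n t ->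
  exists2 m, column m = column n & removed m t.
Proof.
move=> nt.
have ex : exists m, (column m == column n) && (1 / 2 < branch_mass m t).
  by exists n; rewrite eqxx.
have [m /andP[/eqP mn mt] min_m] := ex_minnP ex.
exists m => //; rewrite /removed mt; apply/forallP => k;
  apply/implyP => /eqP km.
rewrite leNgt; apply/negP => kt; have := min_m k.
by rewrite km mn eqxx kt leqNgt ltn_ord => /(_ isT).
Qed.

Lemma not_smooth_removed : ~ smooth R (cube_cpt (branch_family code removed)).
Proof.
move=> [P [[M PM] PP Prange]].
set S := branch_family code removed in P PM PP Prange.
pose mu n s := residual P n (coord R S (inr (inl s))).
(* Uncountably many labels have first component [mu], and only countably many are exceptional. *)
have [b bP] : exists b, forall n,
    residual P n (tail R code removed (mu, b) j) @[j --> \oo] --> (0 : R).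
  apply: contrapT => nex; apply: uncountable_binary.
  have := countable_residual_tail code_inj removed_thin PM PP Prange.
  move=> /pcard_injP[f fI]; apply/pcard_injP; exists (fun b => f (mu, b)).
  have bad b : (mu, b) \in [set t | ~ forall n,
      residual P n (tail R code removed t j) @[j --> \oo] --> (0 : R)].
    by apply/mem_set => /= bP; apply: nex; exists b.
  by move=> b b' _ _ /(fI _ _ (bad b) (bad b'))[].
pose t : label := (mu, b).
(* As the residuals of the tails tend to 0, the column masses sum to the residual of the branch. *)
have massE n : branch_mass n t = residual P n (coord R S (inr (inr t))).
  apply/cvg_lim => //; have := bP n.
  move=> /(cvgB (cvg_cst (residual P n (coord R S (inr (inr t)))))).
  rewrite subr0; apply: cvg_trans; apply: near_eq_cvg; apply: nearW => j.
  rewrite -[LHS]/(_ - residual P n (tail R code removed t j)).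
  by rewrite residual_tailE subKr.
have h0 : 0 < 1 / 2 :> R by rewrite divr_gt0.
have [N _ NP] := residual_cvg Prange (coord R S (inr (inr t))) h0.
(* The column of level [l] lies beyond [N], where indicator and residual of the branch differ by
   less than 1/2. *)
have [l lN] := branch_beyond (code t) N.
(* Mass above 1/2 would give a removed point [m] in this column, with indicator 0 but residual above
   1/2. *)
have colP n :
  column n = Some (mkseq (code t) l) -> ~~ (1 / 2 < branch_mass n t).
  move=> nl; apply/negP => /removed_exists[m mn mr].
  have := NP m (lN m _); rewrite mn nl => /(_ erefl).
  rewrite -massE coord_emb_inr /= mr andbF sub0r normrN =>
    /(le_lt_trans (ler_norm _)).
  by case/andP: mr => mt _ /(lt_trans mt); rewrite ltxx.
(* So the column keeps all its points, with indicator 1 but residual at most 1/2. *)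
have [n _ nl] := column_infinite (Some (mkseq (code t) l)) 0.
have nr : removed n t = false.
  by apply/negbTE/negP => /andP[nt _]; have := colP n nl; rewrite nt.
have := NP n (lN n nl).
rewrite -massE coord_emb_inr /= nr nl in_branch_mkseq /=.
have := colP n nl; rewrite -leNgt => n12 /(le_lt_trans (ler_norm _)).
by rewrite ltrBlDr => /lt_le_trans /(_ (lerD (lexx _) n12));
  rewrite -splitr ltxx.
Qed.

End diagonal.

Theorem corollary4p4 (R : realType) :
  exists gamma eta : compactification nat,
    homeomorphic (set_type (remainder gamma)) (set_type (remainder eta)) /\
    smooth R eta /\ ~ smooth R gamma.
Proof.
exists (cube_cpt (branch_family (@code R) (@removed R))).
exists (cube_cpt (branch_family (@code R) (fun _ _ => false))).
split; last split.
- apply: remainder_homeomorphic => z.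
  by apply: branch_family_recursE; [exact: code_inj|exact: removed_thin].
- by apply: recurs_smooth => n; exact: branch_family_recurs.
- exact: not_smooth_removed.
Qed.
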